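(* Let $\Delta\ge 1$ and $r\ge 1$ be integers and let $\mathcal{T}^r_\Delta$ be the full $\Delta$-ary tree of radius $r$. If a poset $\mathcal{P}=(X,\preceq)$ admits a CPT model in the host tree $\mathcal{T}^r_\Delta$, then $$\dim(\mathcal{P}) \leq \alpha(\mathcal{T}^r_\Delta) + 1.$$
   Context: The full $\Delta$-ary tree $\mathcal{T}^r_\Delta$ of radius $r$ is the rooted tree in which every non-leaf node has exactly $\Delta$ children and every leaf is at distance exactly $r$ from the root. A containment model of a poset $\mathcal{P}=(X,\preceq)$ assigns to each $x\in X$ a set $M_x$ such that for all distinct $x,y\in X$, $x\preceq y$ iff $M_x\subsetneq M_y$. $\mathcal{P}$ admits a CPT model in a tree $\mathcal{T}$ if it has a containment model $(P_x)_{x\in X}$ in which every $P_x$ is (the vertex set of) a path of $\mathcal{T}$. A realizer of $\mathcal{P}$ is a family of linear orders on $X$ such that for distinct $x,y$, $x\preceq y$ iff $x$ precedes $y$ in every member; $\dim(\mathcal{P})$ is the minimum size of a realizer. A drawing of a rooted tree is a planar straight-line drawing with the root highest, each node above all other nodes of its subtree, and nodes at the same depth at the same height; equivalently, it fixes a left-to-right order of the children of every node. The preorder traversal of a drawing lists the root, then recursively traverses the children's subtrees from left to right. Two nodes of a rooted tree are incomparable if neither is a descendant of the other. A family $D$ of drawings of a rooted tree $\mathcal{T}$ is $3$-suitable if for every set $\{a_1,a_2,a_3\}$ of three pairwise incomparable vertices and every distinguished element, say $a_3$, there is a drawing in $D$ whose preorder traversal lists $a_3$ after both $a_1$ and $a_2$.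 $\alpha(\mathcal{T})$ denotes the minimum size of a $3$-suitable family of drawings of $\mathcal{T}$.
   Formalization: Families of drawings are required to be nonempty, so α ≥ 1; with the empty family allowed, α would be 0 for Δ = 1 and for Δ = 2, r = 1, and the bound would fail (two incomparable one-vertex paths give dimension 2). *)

(* Defs.v *)
From mathcomp Require Import all_boot all_order all_fingroup.

Set Implicit Arguments.
Unset Strict Implicit.
Unset Printing Implicit Defensive.

Section FullTree.
Variables Delta r : nat.

(* A vertex of the full Delta-ary tree of radius r is the word of child labels
   read from the root down to it: the root is the empty word, the words of
   length r are the leaves, and u is an ancestor of v iff u is a prefix of v. *)
Definition vertex := r.-bseq 'I_Delta.

Definition root_vertex : vertex := [bseq].

(* Only meaningful when size v < r. *)
Definition child (v : vertex) (i : 'I_Delta) : vertex :=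
  insub_bseq r (rcons v i).

Definition is_child (u v : vertex) : bool :=
  [exists i : 'I_Delta, (v : seq 'I_Delta) == rcons u i].

Definition adjacent (u v : vertex) : bool := is_child u v || is_child v u.

Definition is_tree_path (A : {set vertex}) : Prop :=
  exists u p, [/\ path adjacent u p, uniq (u :: p) & A = [set v in u :: p]].

Definition descendant (v u : vertex) : bool := prefix u v.

Definition incomparable (u v : vertex) : bool :=
  ~~ descendant u v && ~~ descendant v u.

(* D v i is the label of the i-th child of v from the left; the value of D at
   the leaves plays no role. *)
Definition drawing := {ffun vertex -> {perm 'I_Delta}}.

(* Preorder traversal of the first n levels below v; n is the height of v. *)
Fixpoint preorder_from (n : nat) (D : drawing) (v : vertex) : seq vertex :=
  v :: if n is m.+1 then
         flatten [seq preorder_from m D (child v (D v i)) | i <- enum 'I_Delta]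
       else [::].

Definition preorder (D : drawing) : seq vertex := preorder_from r D root_vertex.

Definition precedes (D : drawing) (u v : vertex) : bool :=
  index u (preorder D) < index v (preorder D).

(* The distinguished element is a3. *)
Definition suitable3 (F : {set drawing}) : bool :=
  [forall a1, forall a2, forall a3,
    [&& incomparable a1 a2, incomparable a1 a3 & incomparable a2 a3] ==>
    [exists D in F, precedes D a1 a3 && precedes D a2 a3]].

(* Families of drawings are nonempty: the empty family would be vacuously
   3-suitable for a tree without three pairwise incomparable vertices. *)
Definition alpha : nat :=
  #|[arg min_(F < [set: drawing] | (F != set0) && suitable3 F) #|F| ]|.

End FullTree.

Arguments is_tree_path {Delta r} A.

Section Posets.
Variables (disp : Order.disp_t) (X : porderType disp).

Definition linear_order (L : rel X) : Prop :=
  [/\ reflexive L, antisymmetric L, transitive L & total L].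

Definition realizer (n : nat) (L : 'I_n -> rel X) : Prop :=
  (forall i, linear_order (L i)) /\
  (forall x y : X, x != y -> (x <= y)%O <-> (forall i, L i x y)).

Definition has_dim (n : nat) : Prop :=
  (exists L : 'I_n -> rel X, realizer L) /\
  (forall m (L : 'I_m -> rel X), realizer L -> n <= m).

Definition containment_model (T : finType) (M : X -> {set T}) : Prop :=
  forall x y : X, x != y -> (x <= y)%O <-> M x \proper M y.

Definition admits_CPT_model (Delta r : nat) : Prop :=
  exists M : X -> {set vertex Delta r},
    containment_model M /\ forall x, is_tree_path (M x).

End Posets.

Section Preorder.
Variables Delta r : nat.
Implicit Types (D : drawing Delta r) (v w : vertex Delta r).

Lemma val_child v i : size v < r -> child v i = rcons v i :> seq _.
Proof. by move=> h; rewrite /child /insub_bseq insubdK // -topredE /= size_rcons. Qed.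

Lemma prefix_child v w : prefix v w -> w != v ->
  size v < r /\ exists i, prefix (child v i) w.
Proof.
case/prefixP=> -[|i s] ws nwv.
  by case/eqP: nwv; apply/val_inj; rewrite /= ws cats0.
have sv : size v < r.
  have := size_bseq w; rewrite ws size_cat /= addnS => h.
  by apply: leq_trans h; rewrite ltnS leq_addr.
split=> //; exists i; rewrite val_child // ws.
by rewrite -cat_rcons prefix_prefix.
Qed.

Lemma prefix_child_inj v w i j : size v < r ->
  prefix (child v i) w -> prefix (child v j) w -> i = j.
Proof.
move=> sv; rewrite !val_child // => /prefixP[s ->] /prefixP[t].
by rewrite !cat_rcons => /eqP; rewrite eqseq_cat // => /andP[_ /eqP[]].
Qed.

Lemma mem_preorder_from n D v w : size v + n = r ->
  (w \in preorder_from n D v) = prefix v w.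
Proof.
elim: n v => [|n IH] v svn.
  rewrite /= inE; apply/eqP/idP => [->|/prefixP[s ws]]; first exact: prefix_refl.
  have := size_bseq w; rewrite ws size_cat -[X in _ <= X]svn leq_add2l leqn0.
  by rewrite size_eq0 => /eqP s0; apply/val_inj; rewrite /= ws s0 cats0.
have sv : size v < r by rewrite -[X in _ < X]svn addnS ltnS leq_addr.
have sc i : size (child v i) + n = r.
  by rewrite val_child // size_rcons addSnnS.
rewrite /= inE; apply/idP/idP.
  case/orP=> [/eqP->|]; first exact: prefix_refl.
  case/flatten_mapP=> i _; rewrite IH // val_child // => /prefixP[s ->].
  by rewrite cat_rcons prefix_prefix.
move=> vw; case: eqVneq => //= nwv.
have [_ [i ci]] := prefix_child vw nwv.
apply/flatten_mapP; exists ((D v)^-1%g i); first by rewrite mem_enum.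
by rewrite permKV IH.
Qed.

End Preorder.

(* In a drawing that puts the child towards a rightmost at each ancestor of a,
   every vertex incomparable to a comes before a. *)
Lemma exists_drawing_last Delta r (a : vertex Delta r) :
  exists D, forall b, incomparable b a -> precedes D b a.
Proof.
case: Delta a => [|m] a.
  exists [ffun=> 1%g] => b; rewrite /incomparable /descendant.
  by case: (a) => -[|[]//] ? /=; rewrite prefix0s.
pose dir (v : vertex m.+1 r) := nth ord0 a (size v).
pose D : drawing m.+1 r := [ffun v => tperm ord_max (dir v)].
exists D => b /andP[nba nab].
rewrite /precedes /preorder.
suff H n (v : vertex m.+1 r) : size v + n = r -> prefix v a -> prefix v b ->
    index b (preorder_from n D v) < index a (preorder_from n D v).
  by apply: H; rewrite //= prefix0s.
elim: n v => [|n IH] v svn va vb.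
  case/negP: nba; rewrite /descendant; suff -> : val a = val v by [].
  have /= := mem_preorder_from D a svn; rewrite va inE => /eqP->.
  by [].
have nav : a != v by apply: contraNneq nba => ->; exact: vb.
have nbv : b != v by apply: contraNneq nab => ->; exact: va.
have [sv [i ia]] := prefix_child va nav.
have [_ [j jb]] := prefix_child vb nbv.
have sc k : size (child v k) + n = r.
  by rewrite val_child // size_rcons addSnnS.
have di : dir v = i.
  move: (ia); rewrite val_child // => /prefixP[s as_].
  by rewrite /dir as_ cat_rcons nth_cat ltnn subnn.
have Dmax : D v ord_max = i by rewrite ffunE di tpermL.
rewrite /= ![v == _]eq_sym (negPf nav) (negPf nbv) ltnS.
rewrite enum_ordSr map_rcons flatten_rcons Dmax.
set s := flatten _.
have mems (w : vertex m.+1 r) k : prefix (child v k) w -> (w \in s) = (k != i).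
  move=> kw; apply/flatten_mapP/idP.
    case=> l /mapP[l' _ ->]; rewrite mem_preorder_from // => lw.
    rewrite (prefix_child_inj sv kw lw) -Dmax (inj_eq perm_inj).
    by rewrite -val_eqE /= neq_ltn ltn_ord.
  move=> nki; have : (D v)^-1%g k != ord_max.
    by apply: contraNneq nki => e; rewrite -Dmax -e permKV.
  move=> nk; exists ((D v)^-1%g k); last by rewrite permKV mem_preorder_from.
  have lt : (D v)^-1%g k < m.
    rewrite ltn_neqAle -ltnS ltn_ord andbT.
    by apply: contraNneq nk => e; apply/eqP/val_inj.
  by apply/mapP; exists (Ordinal lt); rewrite ?mem_enum //; apply/val_inj.
rewrite !index_cat (mems _ _ ia) (mems _ _ jb) eqxx /=.
case: eqVneq => [ji|nji] /=.
  by rewrite ltn_add2l; apply: IH; rewrite // -ji.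
by apply: leq_trans (leq_addr _ _); rewrite index_mem (mems _ _ jb).
Qed.

(* The family of all drawings is 3-suitable, so the minimum defining alpha is
   taken over a nonempty collection. *)
Lemma suitable3T Delta r : suitable3 [set: drawing Delta r].
Proof.
apply/'forall_'forall_forallP => a1 a2 a3; apply/implyP => /and3P[_ i13 i23].
have [D HD] := exists_drawing_last a3.
by apply/existsP; exists D; rewrite inE !HD.
Qed.

Lemma setT_drawing_neq0 Delta r : [set: drawing Delta r] != set0.
Proof. by apply/set0Pn; exists [ffun=> 1%g]; rewrite inE. Qed.


Lemma alphaP Delta r :
  (exists F : {set drawing Delta r},
     [/\ F != set0, suitable3 F & #|F| = alpha Delta r]) /\
  (forall F : {set drawing Delta r},
     F != set0 -> suitable3 F -> alpha Delta r <= #|F|).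
Proof.
rewrite /alpha; case: arg_minnP => [|F /andP[F0 sF] minF].
  by rewrite setT_drawing_neq0 suitable3T.
by split=> [|G G0 sG]; [exists F | rewrite minF // G0].
Qed.

(* Main.v *)
From mathcomp Require Import all_boot all_order perm.
From mathcomp Require wochoice.
Require Import Defs.

(** Rank a path by the last preorder position of its vertices in each drawing of
    a minimum 3-suitable family, and once more by how high it reaches in the
    tree; these ranks are monotone for inclusion, so breaking ties by cardinality
    gives linear extensions. If [P] is not included in [Q], pick [a] in [P] but
    not in [Q]. Either [a] is a proper ancestor of the top of [Q], and [P] reaches
    higher than [Q]; or [a] is an ancestor of neither end of [Q], and 3-suitability
    provides a drawing in which [a] comes after both ends, hence after all of [Q].
    When one end is redundant only a pair has to be ordered; it is completed to an
    incomparable triple, which is possible in every tree except the one with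
    exactly two leaves. That tree is a path. *)

Set Implicit Arguments.
Unset Strict Implicit.
Unset Printing Implicit Defensive.

(** * Ranks of finite sets *)

Definition max_rank (T : finType) (f : T -> nat) (A : {set T}) : nat :=
  \max_(v in A) (f v).+1.

Lemma max_rank_sub (T : finType) (f : T -> nat) (A B : {set T}) :
  A \subset B -> max_rank f A <= max_rank f B.
Proof.
by move/subsetP=> AB; apply/bigmax_leqP=> v /AB; apply: leq_bigmax_cond.
Qed.

(** The successor in [max_rank] lets this cover an empty [B], whose rank is 0. *)
Lemma max_rank_lt (T : finType) (f : T -> nat) (A B : {set T}) a :
  a \in A -> (forall v, v \in B -> f v < f a) -> max_rank f B < max_rank f A.
Proof.
move=> aA lt; apply: (@leq_trans (f a).+1); last exact: leq_bigmax_cond.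
by rewrite ltnS; apply/bigmax_leqP.
Qed.

(** * Linear orders, dimension and realizers built from ranks *)

Section LinearOrders.
Variables (disp : Order.disp_t) (X : porderType disp).

Lemma linear_order_exists : exists W : rel X, linear_order W.
Proof.
have [W woW] := wochoice.well_ordering_principle X.
have chW : wochoice.wo_chain W predT by move=> A _; apply: woW.
have totW : total W by move=> x y; apply: wochoice.wo_chainW chW _ _ _ _.
have antiW : antisymmetric W.
  by move=> x y; apply: (wochoice.wo_chain_antisymmetric chW).
have reflW : reflexive W by move=> x; have := totW x x; rewrite orbb.
exists W; split=> // y x z xy yz.
(* Transitivity comes from the least element of {x, y, z}: if it is [y] or [z], antisymmetry
   identifies two of the three. *)
have [|m [[mA minm] _]] := woW [pred u | (u == x) || (u == y) || (u == z)].
  by exists x; rewrite inE eqxx.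
have [mx my mz] : [/\ W m x, W m y & W m z].
  by split; apply: minm; rewrite !inE eqxx ?orbT.
case/orP: mA => [/orP[]|] /eqP e; move: mx my mz; rewrite e => // mx my mz.
- by rewrite (antiW x y) ?xy.
- by rewrite -(antiW y z) ?yz.
Qed.

Lemma linear_order_rev (W : rel X) :
  linear_order W -> linear_order (fun x y => W y x).
Proof.
case=> reflW antiW transW totW; split=> //.
- by move=> x y xy; apply: antiW; rewrite andbC.
- by move=> y x z xy yz; apply: transW yz xy.
Qed.

Definition lex_rank (f : X -> nat) (W : rel X) : rel X :=
  fun x y => (f x < f y) || ((f x == f y) && W x y).

Lemma lex_rank_linear (f : X -> nat) (W : rel X) :
  linear_order W -> linear_order (lex_rank f W).
Proof.
case=> reflW antiW transW totW; rewrite /lex_rank; split.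
- by move=> x; rewrite eqxx reflW orbT.
- by move=> x y; case: ltngtP => //= _; apply: antiW.
- move=> y x z; case: (ltngtP (f x) (f y)) => //= [lt _|-> xy].
    case: (ltngtP (f y) (f z)) => //= [lt'|<-]; last by rewrite lt.
    by rewrite (ltn_trans lt lt').
  by case: ltngtP => //= _; apply: transW xy.
- by move=> x y; case: ltngtP => //= _; apply: totW.
Qed.

(** Descent to a realizer of minimum size; whether a smaller one exists is decided classically. *)
Lemma has_dim_le_realizer n (L : 'I_n -> rel X) :
  realizer L -> exists m, has_dim X m /\ m <= n.
Proof.
elim: n {-2}n (leqnn n) L => [|k IH] n.
  rewrite leqn0 => /eqP-> L rL; exists 0; split=> //; split=> //.
  by exists L.
move=> nk L rL.
have [[m [L' [rL' mn]]]|no] :=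
  boolp.pselect (exists m (L' : 'I_m -> rel X), realizer L' /\ m < n).
  have [|m' [dm' m'm]] := IH m _ L' rL'; first by rewrite -ltnS (leq_trans mn).
  by exists m'; split=> //; apply: leq_trans m'm (ltnW mn).
exists n; split=> //; split=> [|m L' rL']; first by exists L.
by rewrite leqNgt; apply/negP=> mn; case: no; exists m, L'.
Qed.

(* Distinct elements may have the same model, and X may be infinite; such twins
   are separated by an arbitrary linear order and its reverse, hence two
   indices are needed. *)
Lemma realizer_of_ranks (T : finType) (M : X -> {set T}) n
    (f : nat -> T -> nat) :
  containment_model M -> 1 < n ->
  (forall x y, ~~ (M x \subset M y) -> exists2 i, i < n &
     exists2 a, a \in M x & forall v, v \in M y -> f i v < f i a) ->
  exists L : 'I_n -> rel X, realizer L.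
Proof.
move=> cM n1 sep; have [W linW] := linear_order_exists.
pose tie (i : nat) : rel X := if i == 0 then W else fun x y => W y x.
have lin_tie i : linear_order (tie i).
  by rewrite /tie; case: eqP => // _; apply: linear_order_rev.
pose L (i : 'I_n) := lex_rank (max_rank (f i) \o M)
  (lex_rank (fun x => #|M x|) (tie i)).
exists L; split=> [i|x y nxy]; first by do 2!apply: lex_rank_linear.
split=> [/(cM _ _ nxy) xy i|Lxy].
  (* Proper inclusion strictly increases cardinality, so the tie-breaking order is never
     consulted. *)
  rewrite /L /lex_rank (proper_card xy) andbT orbC -leq_eqVlt.
  exact/max_rank_sub/proper_sub.
apply/(cM _ _ nxy); rewrite properEcard.
have [sub|nsub] := boolP (M x \subset M y); last first.
  have [i lt_in [a ax lt]] := sep _ _ nsub.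
  have := Lxy (Ordinal lt_in); rewrite /L /lex_rank /=.
  by have := max_rank_lt ax lt; case: ltngtP.
rewrite /= ltnNge; apply/negP=> cyx.
(* Twins agree in all ranks and cardinalities, so every [Lxy] reduces to its tie order; indices 0
   and 1 give both directions. *)
have e : M x = M y by apply/eqP; rewrite eqEcard sub.
have tieL i : i < n -> tie i x y.
  move=> lt_in; have := Lxy (Ordinal lt_in).
  by rewrite /L /lex_rank /= e !ltnn !eqxx.
case: linW => _ antiW _ _; case/eqP: nxy; apply: antiW.
by apply/andP; split; [apply: (tieL 0 (ltnW n1)) | apply: (tieL 1 n1)].
Qed.

End LinearOrders.

(** * Prefixes of words and positions in concatenations *)

Section Prefixes.
Variable T : eqType.
Implicit Types s t u : seq T.

Lemma prefix_total s t u : prefix s u -> prefix t u -> prefix s t || prefix t s.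
Proof.
elim: u s t => [|x u IH] [|y s] [|z t] //=.
by case/andP=> /eqP-> su /andP[/eqP-> tu]; rewrite eqxx IH.
Qed.

Lemma prefix_size_eq s t : prefix s t -> size t <= size s -> s = t.
Proof. by rewrite prefixE => /eqP {2}<- /take_oversize->. Qed.

Lemma prefix_anti s t : prefix s t -> prefix t s -> s = t.
Proof. by move=> st ts; apply: prefix_size_eq st (size_prefix ts). Qed.

Lemma prefix_rconsE s t x :
  prefix s (rcons t x) = (s == rcons t x) || prefix s t.
Proof.
apply/idP/orP=> [st|[/eqP->|st]]; last 2 first.
- exact: prefix_refl.
- exact: prefix_trans st (prefix_rcons _ _).
have [/(prefix_size_eq st)->|lt] := leqP (size (rcons t x)) (size s).
  by left.
right; have /orP[//|ts] := prefix_total st (prefix_rcons t x).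
by rewrite (prefix_size_eq ts) ?prefix_refl // -ltnS -(size_rcons t x).
Qed.

End Prefixes.

(** The first block containing [x] is also the first containing [y], and the blocks before it shift
    both indices equally. *)
Lemma index_flatten_lt (T S : eqType) (e : seq S) (f : S -> seq T) x y :
  (forall i, i \in e -> (x \in f i) = (y \in f i)) ->
  (forall i, i \in e -> x \in f i -> index x (f i) < index y (f i)) ->
  x \in flatten (map f e) ->
  index x (flatten (map f e)) < index y (flatten (map f e)).
Proof.
elim: e => [|i e IH] //= eqxy lt; rewrite mem_cat !index_cat.
rewrite -eqxy ?mem_head //; case: ifP => [xi _|_ /= xe].
  by apply: lt; rewrite ?mem_head.
rewrite ltn_add2l IH // => j je; first by apply: eqxy; rewrite inE je orbT.
by apply: lt; rewrite inE je orbT.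
Qed.

Lemma exists_notin (T : finType) (s : seq T) :
  size s < #|T| -> exists x, x \notin s.
Proof.
move=> lt; apply/existsP; apply: contraLR lt; rewrite negb_exists -leqNgt.
move/forallP=> mem; apply: leq_trans (card_size s).
by apply: subset_leq_card; apply/subsetP=> x _; have := mem x; rewrite negbK.
Qed.

(** * Paths, traversals and leaves of the full tree *)

Section Trees.
Variables Delta r : nat.
Implicit Types (u v w a b c t : vertex Delta r) (D : drawing Delta r).

(** A path climbs from one end to its highest vertex [t] and descends to the other end. Induction
    prepends a vertex [u] to a path starting at [w]. *)
Lemma tree_path_shape (A : {set vertex Delta r}) : is_tree_path A ->
  exists t a b, [/\ prefix t a, prefix t b &
    forall v, (v \in A) = prefix t v && (prefix v a || prefix v b)].
Proof.
case=> u [p [pp up ->]].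
suff [t [b [tu tb mem]]] : exists t b, [/\ prefix t u, prefix t b &
    forall v, (v \in u :: p) = prefix t v && (prefix v u || prefix v b)].
  by exists t, u, b; split=> // v; rewrite inE mem.
elim: p u pp up => [|w p IH] u /=.
  move=> _ _; exists u, u; split; rewrite ?prefix_refl // => v.
  rewrite inE orbb.
  apply/eqP/andP=> [->|[uv vu]]; first by rewrite prefix_refl.
  exact/val_inj/prefix_anti.
case/andP=> adj pp /andP[nu up].
have [t [b [tw tb mem]]] := IH _ pp up.
case/orP: adj => /existsP[i /eqP e].
  (* Here [u] is the parent of [w]. Were the top strictly above [w], [u] would already lie on the
     path; so [w] is the top, and [u] becomes the new one. *)
  have tu : t = w.
    have : prefix t w := tw; rewrite e prefix_rconsE => /orP[/eqP tw'|tu].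
      by apply/val_inj; rewrite /= tw'.
    by move: nu; rewrite mem tu e prefix_rcons.
  exists u, b; rewrite prefix_refl.
  have uw : prefix u w by rewrite e prefix_rcons.
  rewrite tu in tb mem; split=> //; first exact: prefix_trans uw tb.
  move=> v; rewrite inE mem.
  apply/orP/andP=> [[/eqP->|/andP[wv vwb]]|[uv vub]].
  - by rewrite !prefix_refl.
  - split; first exact: prefix_trans uw wv.
    case/orP: vwb => [vw|->]; last by rewrite orbT.
    by rewrite (prefix_trans vw tb) orbT.
  - case: (eqVneq v u) => [//|nvu]; [by left|right].
    case/orP: vub => [vu|vb].
      by case/eqP: nvu; apply/val_inj/prefix_anti.
    rewrite vb orbT andbT.
    case/orP: (prefix_total tb vb) => //.
    rewrite e prefix_rconsE => /orP[/eqP->|vu].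
      exact: prefix_refl.
    by case/eqP: nvu; apply/val_inj/prefix_anti.
(* Here [u] is a child of [w]: the top stays, and the end [w] moves down to [u]. *)
exists t, b; have wu : prefix w u by rewrite e prefix_rcons.
have tu := prefix_trans tw wu.
split=> // v; rewrite inE mem [in prefix v u]e prefix_rconsE -e.
case: (eqVneq v u) => [->|nvu]; first by rewrite eqxx tu.
by rewrite val_eqE (negPf nvu).
Qed.

(** Descending from the root, both vertices stay in the same child's subtree until [a] is reached,
    and [a] is listed first there. *)
Lemma prefix_precedes D a b : prefix a b -> a != b -> precedes D a b.
Proof.
move=> ab nab; rewrite /precedes /preorder.
suff H n v : size v + n = r -> prefix v a ->
    index a (preorder_from n D v) < index b (preorder_from n D v).
  by apply: H; rewrite //= prefix0s.
elim: n v => [|n IH] v svn va.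
  case/eqP: nab; apply/val_inj; apply: prefix_size_eq => //.
  apply: leq_trans (size_bseq b) _.
  by rewrite -[X in X <= _]svn addn0 size_prefix.
have vb : prefix v b := prefix_trans va ab.
rewrite /=; case: (eqVneq v a) => [->|nva]; first by rewrite (negPf nab).
have nvb : v != b.
  by apply: contraNneq nva => e; apply/eqP/val_inj/prefix_anti => //; rewrite e.
rewrite (negPf nvb) ltnS.
have [sv [k ka]] : size v < r /\ exists i, prefix (child v i) a.
  by apply: prefix_child => //; rewrite eq_sym.
have sc i : size (child v i) + n = r.
  by rewrite val_child // size_rcons addSnnS.
apply: index_flatten_lt => [i _|i _|].
- rewrite !mem_preorder_from //; apply/idP/idP=> [ia|ib].
    exact: prefix_trans ia ab.
  by rewrite (prefix_child_inj sv ib (prefix_trans ka ab)).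
- by rewrite mem_preorder_from // => ia; apply: IH.
- have : a \in preorder_from n.+1 D v by rewrite mem_preorder_from.
  by rewrite /= inE eq_sym (negPf nva).
Qed.

Lemma vertex_of_seq (s : seq 'I_Delta) :
  size s <= r -> exists v : vertex Delta r, v = s :> seq _.
Proof. by move=> sr; exists (Bseq sr). Qed.

Lemma exists_third_leaf a b : size a = r -> ~~ prefix b a -> 1 < Delta ->
  ~~ ((Delta == 2) && (r == 1)) ->
  exists c, incomparable a c && incomparable b c.
Proof.
move=> sa nba D1 nd.
(* A leaf is comparable only to its own prefixes, so [c] is sought among the leaves. *)
suff [c [sc nca nbc]] : exists c, [/\ size c = r, c != a & ~~ prefix b c].
  exists c; rewrite /incomparable /descendant nbc !andbT.
  have sub v : prefix c v -> c = v.
    by move=> cv; apply/val_inj/prefix_size_eq; rewrite // sc size_bseq.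
  rewrite andbC; apply/and3P; split.
  - by apply: contraNN nbc => /sub->; apply: prefix_refl.
  - by apply: contraNN nca => /sub->.
  - apply: contraNN nca => ac; rewrite eq_sym; apply/eqP/val_inj.
    by apply: prefix_size_eq; rewrite // sa size_bseq.
case/lastP ea: (val a) => [|w i].
  have r0 : r = 0 by rewrite -sa ea.
  case/negP: nba; have := size_bseq b; rewrite [X in _ <= X]r0 leqn0 size_eq0.
  by move/eqP->; apply: prefix0s.
have sw : (size w).+1 = r by rewrite -sa ea size_rcons.
(* As [b] is not above [a], a sibling of [a] can lie below [b] only by being [b] itself. *)
have sib j : j != i -> (b : seq _) != rcons w j ->
    exists c, [/\ size c = r, c != a & ~~ prefix b c].
  move=> ji nb; have [|c ec] := @vertex_of_seq (rcons w j).
    by rewrite size_rcons sw.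
  exists c; split; first by rewrite ec size_rcons.
    by rewrite -val_eqE /= ec ea eqseq_rcons (negPf ji) andbF.
  rewrite ec prefix_rconsE (negPf nb) /=; apply: contraNN nba => bw.
  by rewrite ea prefix_rconsE bw orbT.
have [D2|D2] := ltnP 2 Delta.
  have [|j] := @exists_notin _ [:: i; last i b]; first by rewrite card_ord.
  rewrite !inE negb_or => /andP[ji jb]; apply: (sib j ji).
  by apply: contraNneq jb => ->; rewrite last_rcons.
have [|j] := @exists_notin _ [:: i]; first by rewrite card_ord.
rewrite inE => ji.
have [eb|nb] := eqVneq (b : seq _) (rcons w j); last exact: sib nb.
case: w => [|k w] in ea sw eb {sib}.
  by case/negP: nd; rewrite eqn_leq D2 D1 -sw.
have [|k'] := @exists_notin _ [:: k]; first by rewrite card_ord.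
rewrite inE => kk.
(* The only sibling of [a] is [b]; since [r > 1], changing the first label gives a leaf in another
   branch. *)
have [|c ec] := @vertex_of_seq (k' :: rcons w i).
  by rewrite /= size_rcons; move: sw => /= ->.
exists c; split; first by rewrite ec /= size_rcons.
  by rewrite -val_eqE /= ec ea eqseq_cons (negPf kk).
by rewrite ec eb /= eq_sym (negPf kk).
Qed.

(** * Separating tree paths by a 3-suitable family *)

Section Suitable.
Variable F : {set drawing Delta r}.
Hypotheses (F0 : F != set0) (sF : suitable3 F).

Lemma suitable3_last a b c :
  incomparable a b -> incomparable a c -> incomparable b c ->
  exists2 D, D \in F & precedes D a c && precedes D b c.
Proof.
move=> ab ac bc; move/forallP: sF => /(_ a)/forallP/(_ b)/forallP/(_ c).
by rewrite ab ac bc => /existsP[D /andP[DF pD]]; exists D.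
Qed.

Hypothesis nd : ~~ ((Delta == 2) && (r == 1)).

Lemma suitable3_pair a b :
  ~~ prefix b a -> exists2 D, D \in F & precedes D a b.
Proof.
move=> nba; have [ab|nab] := boolP (prefix a b).
  have /set0Pn[D DF] := F0; exists D => //; apply: prefix_precedes => //.
  by apply: contraNneq nba => ->; apply: prefix_refl.
have iab : incomparable a b by rewrite /incomparable /descendant nba nab.
(* With at most one label, any two words are comparable. *)
have [D1|D1] := leqP Delta 1.
  suff : prefix a b || prefix b a by rewrite (negPf nab) (negPf nba).
  have eqI (i j : 'I_Delta) : i = j.
    by apply/val_inj; case: i j => [[|i] Hi] [[|j] Hj] //=;
      have := leq_trans Hi D1; have := leq_trans Hj D1.
  elim: (val a) (val b) => [|x s IH] [|y t] //=.
  by rewrite (eqI x y) eqxx /= IH.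
(* A leaf [a] is completed by a third leaf. An inner [a] is replaced by two of its children: a
   drawing listing them before [b] lists [a] even earlier. *)
have [lt_ar|le_ra] := ltnP (size a) r; last first.
  have [|c /andP[ac bc]] := exists_third_leaf _ nba D1 nd.
    by apply/eqP; rewrite eqn_leq le_ra size_bseq.
  have ca : incomparable c a by rewrite /incomparable andbC.
  have cb : incomparable c b by rewrite /incomparable andbC.
  by have [D DF /andP[_ pD]] := suitable3_last ca cb iab; exists D.
pose i0 := Ordinal (ltnW D1); pose i1 := Ordinal D1.
have icb i : incomparable (child a i) b.
  rewrite /incomparable /descendant val_child //; apply/andP; split.
    rewrite prefix_rconsE negb_or nba andbT; apply: contraNneq nab => ->.
    exact: prefix_rcons.
  by apply: contraNN nab; apply: prefix_trans (prefix_rcons _ _).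
have [|D DF /andP[pD _]] := suitable3_last _ (icb i0) (icb i1).
  rewrite /incomparable /descendant !val_child // !prefix_rconsE !eqseq_rcons.
  by rewrite !andbF /= -!cats1; apply/andP; split; apply/negP=> /size_prefix;
    rewrite size_cat addn1 ltnn.
exists D => //; apply: ltn_trans pD; apply: prefix_precedes.
  by rewrite val_child // prefix_rcons.
apply/eqP=> /(congr1 (fun v : vertex Delta r => size v)).
by rewrite val_child // size_rcons => /eqP; rewrite eqn_leq ltnn andbF.
Qed.

Lemma prefix_index_leq D a b :
  prefix a b -> index a (preorder D) <= index b (preorder D).
Proof.
have [->//|nab] := eqVneq a b.
by move=> ab; apply: ltnW; apply: prefix_precedes.
Qed.

(** Any comparability leaves one pair to order: if one of [a1], [a2] is above the other, it comes
    before it; if one is above [a3], it precedes [a3] in every drawing. *)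
Lemma suitable3_after a1 a2 a3 : ~~ prefix a3 a1 -> ~~ prefix a3 a2 ->
  exists2 D, D \in F & precedes D a1 a3 && precedes D a2 a3.
Proof.
wlog n21 : a1 a2 / ~~ prefix a2 a1.
  move=> H n31 n32; have [p21|n21] := boolP (prefix a2 a1); last exact: H.
  have [D DF pD] := suitable3_pair n31; exists D => //; rewrite pD.
  exact: leq_ltn_trans (prefix_index_leq D p21) pD.
move=> n31 n32.
have [p13|n13] := boolP (prefix a1 a3).
  have [D DF pD] := suitable3_pair n32; exists D => //; rewrite pD andbT.
  apply: prefix_precedes => //; apply: contraNneq n31 => ->.
  exact: prefix_refl.
have [p12|n12] := boolP (prefix a1 a2).
  have [D DF pD] := suitable3_pair n32; exists D => //; rewrite pD andbT.
  exact: leq_ltn_trans (prefix_index_leq D p12) pD.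
have [p23|n23] := boolP (prefix a2 a3).
  have [D DF pD] := suitable3_pair n31; exists D => //; rewrite pD /=.
  apply: prefix_precedes => //; apply: contraNneq n32 => ->.
  exact: prefix_refl.
by apply: suitable3_last; rewrite /incomparable /descendant; apply/andP.
Qed.

Lemma separate_tree_paths (P Q : {set vertex Delta r}) :
  is_tree_path Q -> ~~ (P \subset Q) ->
  (exists2 a, a \in P & forall v, v \in Q -> r - size v < r - size a) \/
  (exists2 D, D \in F & exists2 a, a \in P &
     forall v, v \in Q -> precedes D v a).
Proof.
case/tree_path_shape=> t [a1 [a2 [ta1 ta2 memQ]]] /subsetPn[a aP].
rewrite memQ => naQ.
have [at_|nat_] := boolP (prefix a t); last first.
  have [n1 n2] : ~~ prefix a a1 /\ ~~ prefix a a2.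
    have [ta|nta] := boolP (prefix t a).
      by move: naQ; rewrite ta /= negb_or => /andP.
    (* Prefixes of a common end are comparable, but [a] and [t] are not. *)
    by split; apply/negP=> /(prefix_total _) H;
      [have := H _ ta1 | have := H _ ta2]; rewrite (negPf nta) (negPf nat_).
  right; have [D DF /andP[p1 p2]] := suitable3_after n1 n2.
  exists D => //; exists a => // v; rewrite memQ => /andP[_ /orP[]] le.
    exact: leq_ltn_trans (prefix_index_leq D le) p1.
  exact: leq_ltn_trans (prefix_index_leq D le) p2.
left; exists a => // v; rewrite memQ => /andP[tv _].
have lt_at : size a < size t.
  rewrite ltnNge; apply: contraNN naQ => le.
  have -> : a = t by apply/val_inj/prefix_size_eq.
  by rewrite prefix_refl ta1.
have lt_av := leq_trans lt_at (size_prefix tv).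
by apply: ltn_sub2l => //; apply: leq_trans lt_av (size_bseq v).
Qed.

End Suitable.

End Trees.

(** * The exceptional tree with two leaves *)

(* Numbers the vertices 0, 1, 2 from one leaf to the other, so that tree paths
   are intervals. *)
Definition cherry_pos (v : vertex 2 1) : nat :=
  if val v is i :: _ then i.*2 else 1.

(** A vertex outside an interval lies on one side of it, so the numbering and its reversal
    suffice. *)
Lemma separate_cherry_paths (P Q : {set vertex 2 1}) :
  is_tree_path Q -> ~~ (P \subset Q) ->
  (exists2 a, a \in P & forall v, v \in Q -> cherry_pos v < cherry_pos a) \/
  (exists2 a, a \in P & forall v, v \in Q ->
     2 - cherry_pos v < 2 - cherry_pos a).
Proof.
have pos_inj : injective cherry_pos.
  move=> [s1 h1] [s2 h2] e; apply/val_inj; move: s1 h1 s2 h2 e => /=.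
  by case=> [|[[|[|//]] ?] [|//]] ? [|[[|[|//]] ?] [|//]] ? //= _;
    congr [:: _]; apply/val_inj.
have pos_le v : cherry_pos v <= 2.
  by case: v => -[|[[|[|//]] ?] [|//]].
case/tree_path_shape=> t [a1 [a2 [ta1 ta2 memQ]]] /subsetPn[a aP naQ].
have neq v : v \in Q -> cherry_pos v != cherry_pos a.
  by move=> vQ; apply: contraNneq naQ => /pos_inj <-.
have [/existsP[v /andP[vQ lt_av]]|] :=
  boolP [exists v in Q, cherry_pos a < cherry_pos v]; last first.
  rewrite negb_exists_in => /forall_inP le; left; exists a => // v vQ.
  by rewrite ltn_neqAle neq // leqNgt le.
have [/existsP[w /andP[wQ lt_wa]]|] :=
  boolP [exists v in Q, cherry_pos v < cherry_pos a]; last first.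
  rewrite negb_exists_in => /forall_inP le; right; exists a => // w wQ.
  have lt : cherry_pos a < cherry_pos w.
    by rewrite ltn_neqAle eq_sym neq // leqNgt le.
  by apply: ltn_sub2l => //; apply: leq_trans lt (pos_le w).
(* If [Q] had vertices on both sides of [a], it would contain both leaves; its top would then be the
   root, which is [a]. *)
have [pw pa pv] : [/\ cherry_pos w = 0, cherry_pos a = 1 & cherry_pos v = 2].
  move: (pos_le v) lt_av lt_wa.
  by case: (cherry_pos v) (cherry_pos a) (cherry_pos w)
    => [|[|[|?]]] [|[|?]] [|?].
case/negP: naQ; have a0 : val a = [::].
  by move: pa; rewrite /cherry_pos; case: (val a) => [//|[[|[|//]]]].
move: wQ vQ; rewrite !memQ a0 prefix0s andbT => /andP[tw _] /andP[tv _].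
move: t w v tw tv pw pv {memQ ta1 ta2 lt_av lt_wa} => [[|x s] ?].
  by [].
move=> [[|y s1] ?] [[|z s2] ?] //=; rewrite /cherry_pos /=.
by move=> /andP[/eqP<- _] /andP[/eqP<- _] ->.
Qed.

(** * The bound on the dimension *)

Theorem theorem4 (Delta r : nat) (hDelta : 1 <= Delta) (hr : 1 <= r)
    (disp : Order.disp_t) (X : porderType disp) :
  admits_CPT_model X Delta r ->
  exists n : nat, has_dim X n /\ n <= alpha Delta r + 1.
Proof.
case=> M [cM pathM].
have [[F [F0 sF <-]] _] := alphaP Delta r.
have cF : 0 < #|F| by rewrite card_gt0.
have [/andP[/eqP D2 /eqP r1]|nd] := boolP ((Delta == 2) && (r == 1)).
  move: M cM pathM F {F0 sF} cF; rewrite D2 r1 => M cM pathM F cF.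
  pose f i v := if i == 0 then cherry_pos v else 2 - cherry_pos v.
  have [//|x y nsub|L rL] := @realizer_of_ranks _ X _ M 2 f cM.
    by case: (separate_cherry_paths (pathM y) nsub); [exists 0 | exists 1].
  have [n [dn n2]] := has_dim_le_realizer rL; exists n; split=> //.
  (* Two orders are within the bound because [F] is nonempty. *)
  by apply: leq_trans n2 _; rewrite addn1.
have /set0Pn[D0 _] := F0.
(* Index 0 ranks by height, index [k.+1] by the [k]-th drawing of [F]; [D0] is only the default of
   [nth]. *)
pose f i (v : vertex Delta r) :=
  if i is k.+1 then index v (preorder (nth D0 (enum F) k)) else r - size v.
have [|x y nsub|L rL] := @realizer_of_ranks _ X _ M (#|F| + 1) f cM.
- by rewrite addn1.
- have [sep|[D DF sep]] := separate_tree_paths F0 sF nd (pathM y) nsub.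
    by exists 0; rewrite // addn1.
  exists (index D (enum F)).+1; last by rewrite /f nth_index ?mem_enum.
  by rewrite addn1 ltnS cardE index_mem mem_enum.
exact: has_dim_le_realizer rL.
Qed.
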